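(* Let $1\le p<\infty$, let $Y$ be a Banach space and let $C\ge1$. If for every $k\in\mathbb{N}$, $D_k^2$ embeds into $Y$ with distortion at most $C$, then for every $k\in\mathbb{N}$, $D_k^\omega$ embeds into $L_p([0,1],Y)$ with distortion at most $2^{1/p}C$. More precisely, for each $k\ge1$ there exists a $1$-Lipschitz map $\bar\phi_k\colon D_k^\omega\to L_p([0,1],Y)$ such that whenever $x$ and $y$ belong to the same vertical path in $D_k^\omega$, $$\|\bar\phi_k(x)-\bar\phi_k(y)\|_p\ge\frac1C d_k(x,y),$$ and whenever $x$ and $y$ do not belong to the same vertical path in $D_k^\omega$, $$\|\bar\phi_k(x)-\bar\phi_k(y)\|_p\ge\frac{1}{2^{1/p}C}d_k(x,y).$$
   Context: Diamond graphs: for $r\in\{2,\omega\}$, $D_0^r$ is the graph with two vertices $b,t$ joined by an edge. For $k\ge 0$, $D_{k+1}^r$ is obtained from $D_k^r$ by removing each edge $\{u,v\}$ and adding instead a set of $r$ new vertices (two if $r=2$, countably infinitely many if $r=\omega$; disjoint sets for distinct edges), each joined by an edge to $u$ and to $v$ and to nothing else. Each graph carries the shortest path metric $d_k$ on its vertex set, edges having length one. Two vertices of $D_k^\omega$ belong to the same vertical path if they are the endpoints of a path in $D_k^\omega$ along which $d_k(b,\cdot)$ is strictly increasing (from one of them to the other). A metric space $X$ embeds into $Z$ with distortion at most $D$ if there are $s>0$ and $f\colon X\to Z$ with $s\,d_X(x,y)\le d_Z(f(x),f(y))\le D s\,d_X(x,y)$ for all $x,y\in X$. $L_p([0,1],Y)$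 is the Bochner space, with norm $\|\cdot\|_p$. *)

(* Defs.v *)
From HB Require Import structures.
From mathcomp Require Import all_boot all_order all_algebra.
From mathcomp Require Import all_classical all_reals all_analysis measurable_realfun.
Set Implicit Arguments.
Unset Strict Implicit.
Unset Printing Implicit Defensive.
Import Order.TTheory GRing.Theory Num.Theory.
Import numFieldNormedType.Exports.
Local Open Scope classical_set_scope.
Local Open Scope ring_scope.
Local Open Scope quotient_scope.

(** * Diamond graphs *)

(* The graph is undirected: [lower] and [upper] only name the two endpoints of
   an edge, and [adjacent] forgets which is which. *)
Record graph := Graph {
  vertex : Type;
  edge : Type;
  lower : edge -> vertex;
  upper : edge -> vertex;
  bottom : vertex;
  top : vertex }.

Definition single_edge : graph :=
  @Graph bool unit (fun=> false) (fun=> true) false true.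

(* The edge e is replaced by the new vertices (e, i), i : I; the edge
   (e, i, false) joins [lower e] to (e, i), and (e, i, true) joins (e, i) to
   [upper e]. *)
Definition subdivide (I : Type) (G : graph) : graph :=
  @Graph (vertex G + edge G * I)%type (edge G * I * bool)%type
    (fun e => if e.2 then inr e.1 else inl (lower e.1.1))
    (fun e => if e.2 then inl (upper e.1.1) else inr e.1)
    (inl (bottom G)) (inl (top G)).

(* D_k^2 is [diamond bool k] and D_k^omega is [diamond nat k]. *)
Definition diamond (I : Type) (k : nat) : graph :=
  iter k (subdivide I) single_edge.

Section graph_metric.
Context (R : realType) (G : graph).
Implicit Types (u v x y : vertex G) (s : seq (vertex G)).

Definition adjacent u v : Prop :=
  exists e : edge G,
    (lower e = u /\ upper e = v) \/ (lower e = v /\ upper e = u).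

Definition adjacentb u v : bool := `[< adjacent u v >].

(* x :: s lists the vertices of the path, so that its length is [size s]; the
   infimum is a minimum because diamond graphs are connected. *)
Definition gdist x y : R :=
  inf [set (size s)%:R | s in [set s | path adjacentb x s /\ last x s = y]].

Definition increasing_path x y : Prop :=
  exists s,
    path (fun u v => adjacentb u v && (gdist (bottom G) u < gdist (bottom G) v))
      x s
    /\ last x s = y.

Definition same_vertical_path x y : Prop :=
  increasing_path x y \/ increasing_path y x.

End graph_metric.

Arguments gdist R {G} x y.
Arguments same_vertical_path R {G} x y.

Definition embeds_with_distortion (R : realType) (X Z : Type)
    (dX : X -> X -> R) (dZ : Z -> Z -> R) (D : R) : Prop :=
  exists2 s : R, 0 < s & exists f : X -> Z, forall x y,
    s * dX x y <= dZ (f x) (f y) /\ dZ (f x) (f y) <= D * s * dX x y.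

Arguments embeds_with_distortion {R} X Z dX dZ D.

Definition norm_dist (R : realType) (V : normedZmodType R) (x y : V) : R :=
  `|x - y|.

(** * Bochner spaces *)

Section strong_measurability.
Context d (T : measurableType d) (R : realType) (Y : normedModType R).

Definition simple_fun (f : T -> Y) : Prop :=
  finite_set (range f) /\ forall y, measurable (f @^-1` [set y]).

(* Every a.e. limit of simple functions is a.e. equal to a function that is
   strongly measurable in this (pointwise) sense, so both conventions give the
   same space of classes. *)
Definition strongly_measurable (f : T -> Y) : Prop :=
  exists s : (T -> Y)^nat,
    (forall n, simple_fun (s n)) /\ forall x, s n x @[n --> \oo] --> f x.

Lemma simple_fun_comp2 (op : Y -> Y -> Y) f g :
  simple_fun f -> simple_fun g -> simple_fun (fun x => op (f x) (g x)).
Proof.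
move=> [ff mf] [fg mg]; split.
  apply: (@sub_finite_set _ _ ((fun z => op z.1 z.2) @` (range f `*` range g))).
    by move=> _ [x _ <-]; exists (f x, g x) => //; split; exists x.
  exact/finite_image/finite_setX.
move=> y; set F := (X in measurable X).
pose P := (range f `*` range g) `&` [set z | op z.1 z.2 = y].
have -> : F = \bigcup_(z in P) (f @^-1` [set z.1] `&` g @^-1` [set z.2]).
  apply/seteqP; split => [x Fx|x [z [_ zy] [/= fz gz]]].
    by exists (f x, g x) => //; do 2?[split => //]; exists x.
  by rewrite /F/= fz gz.
apply: fin_bigcup_measurable => [|z _]; last exact: measurableI.
by apply: finite_setIl; exact: finite_setX.
Qed.

Lemma strongly_measurableB f g : strongly_measurable f ->
  strongly_measurable g -> strongly_measurable (f \- g).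
Proof.
move=> [s [ss sf]] [t [st tg]]; exists (fun n x => s n x - t n x); split.
  by move=> n; exact: (simple_fun_comp2 (fun y z : Y => y - z)).
by move=> x; apply: cvgB; [exact: sf|exact: tg].
Qed.

Lemma strongly_measurable0 : strongly_measurable (cst 0).
Proof.
exists (fun n => cst 0); split => [n|x]; last exact: cvg_cst.
split=> [|y]; first by apply: (@sub_finite_set _ _ [set 0]) => // _ [x _ <-].
rewrite preimage_cst; case: ifP => _; [exact: measurableT|exact: measurable0].
Qed.

Lemma strongly_measurable_norm f : strongly_measurable f ->
  measurable_fun [set: T] (fun x => `|f x|).
Proof.
move=> [s [ss sf]].
apply: (@measurable_fun_cvg _ _ _ _ (fun n x => `|s n x|)).
  move=> n _ A _; rewrite setTI; have [fs ms] := ss n.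
  have -> : (fun x => `|s n x|) @^-1` A =
      \bigcup_(y in range (s n) `&` [set y | A `|y|]) (s n @^-1` [set y]).
    apply/seteqP; split => [x Ax|x [y [_ Ay] /= sxy]]; last by rewrite /= sxy.
    by exists (s n x) => //; split => //; exists x.
  by apply: fin_bigcup_measurable => //; exact: finite_setIl.
by move=> x _; apply: cvg_norm; exact: sf.
Qed.

End strong_measurability.

Section bochner.
Context d (T : measurableType d) (R : realType).
Context (mu : {measure set T -> \bar R}) (p : R) (p1 : 1 <= p).
Context (Y : normedModType R).

Definition bochner_norm (f : T -> Y) : \bar R :=
  ('N[mu]_p%:E[EFin \o (fun x => `|f x|%R)])%E.

Definition bochner_pred : {pred T -> Y} :=
  mem [set f | strongly_measurable f /\ (bochner_norm f < +oo)%E].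

Lemma bochner_normE f : bochner_norm f =
  poweR (\int[mu]_x ((`|f x| `^ p)%:E)) p^-1.
Proof.
rewrite /bochner_norm unlock /=; congr poweR.
by apply: eq_integral => x _; rewrite normr_id.
Qed.

Lemma bochner_normN f : bochner_norm (\- f) = bochner_norm f.
Proof.
by rewrite !bochner_normE; under eq_integral do rewrite normrN.
Qed.

Lemma bochner_norm_triangle f g :
  strongly_measurable f -> strongly_measurable g ->
  (bochner_norm (f \- g)%R <= bochner_norm f + bochner_norm g)%E.
Proof.
move=> mf mg.
have := @minkowski_EFin _ _ _ mu (fun x => `|f x|) (fun x => `|g x|) p
  (strongly_measurable_norm mf) (strongly_measurable_norm mg) p1.
apply: le_trans; rewrite bochner_normE unlock /=.
apply: gt0_ler_poweR; rewrite ?invr_ge0 ?(le_trans ler01)//.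
- by rewrite in_itv/= leey andbT integral_ge0// => x _; rewrite lee_fin powR_ge0.
- by rewrite in_itv/= leey andbT integral_ge0// => x _; rewrite lee_fin powR_ge0.
apply: ge0_le_integral => //.
- apply/measurable_EFinP; apply: (measurableT_comp (measurable_powR p)).
  exact/strongly_measurable_norm/strongly_measurableB.
- apply/measurable_EFinP; apply: (measurableT_comp (measurable_powR p)).
  apply: measurableT_comp => //.
  by apply: measurable_funD; exact: strongly_measurable_norm.
- move=> x _; rewrite lee_fin; apply: ge0_ler_powR.
  + exact: le_trans p1.
  + by rewrite nnegrE normr_ge0.
  + by rewrite nnegrE normr_ge0.
  + by rewrite [leRHS]ger0_norm ?addr_ge0// ler_normB.
Qed.

Lemma bochner_normZ (c : R) f : strongly_measurable f ->
  bochner_norm (fun x => c *: f x) = (`|c|%:E * bochner_norm f)%E.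
Proof.
move=> mf; rewrite !bochner_normE.
under eq_integral do rewrite normrZ powRM// EFinM.
have mfp : measurable_fun [set: T] (fun x => (`|f x| `^ p)%:E).
  apply/measurable_EFinP; apply: (measurableT_comp (measurable_powR p)).
  exact: strongly_measurable_norm.
rewrite ge0_integralZl//.
rewrite poweRM ?lee_fin ?powR_ge0//; last first.
  by apply: integral_ge0 => x _; rewrite lee_fin powR_ge0.
by rewrite poweR_EFin -powRrM mulfV ?powRr1// gt_eqF// (lt_le_trans ltr01).
Qed.

Lemma bochner_norm0 : bochner_norm (cst 0) = 0%E.
Proof.
rewrite /bochner_norm; under eq_Lnorm do rewrite /= normr0.
by rewrite Lnorm0// eqe gt_eqF// (lt_le_trans ltr01).
Qed.

Lemma bochner_zmod_closed : zmod_closed bochner_pred.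
Proof.
split.
  rewrite inE; split; first exact: strongly_measurable0.
  by rewrite [bochner_norm _]bochner_norm0.
move=> f g; rewrite !inE => -[mf lf] [mg lg]; split.
  exact: strongly_measurableB.
exact: (le_lt_trans (bochner_norm_triangle mf mg) (lte_add_pinfty lf lg)).
Qed.

HB.instance Definition _ :=
  GRing.isZmodClosed.Build (T -> Y) bochner_pred bochner_zmod_closed.

Record bochner_fun := BochnerFun {
  bochner_val :> T -> Y;
  bochner_valP : bochner_val \in bochner_pred }.

HB.instance Definition _ := [isSub for bochner_val].
HB.instance Definition _ := [Choice of bochner_fun by <:].
HB.instance Definition _ := [SubChoice_isSubZmodule of bochner_fun by <:].

Lemma bochner_funBE (f g : bochner_fun) x : (f - g) x = f x - g x.
Proof. by []. Qed.

Definition null_pred : {pred bochner_fun} :=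
  mem [set f : bochner_fun | \forall x \ae mu, f x = 0].

Lemma null_zmod_closed : zmod_closed null_pred.
Proof.
split; first by rewrite inE; exact: aeW.
move=> f g; rewrite !inE /= => f0 g0.
by apply: filterS2 f0 g0 => x f0 g0; change (f x - g x = 0); rewrite f0 g0 subr0.
Qed.

HB.instance Definition _ :=
  GRing.isZmodClosed.Build bochner_fun null_pred null_zmod_closed.

(* The space of classes of functions modulo a.e. equality. *)
Definition Lp : Type := Quotient.quot null_pred.

Definition Lp_norm (F : Lp) : R := fine (bochner_norm (repr F : bochner_fun)).

Lemma bochner_fun_sm (f : bochner_fun) : strongly_measurable f.
Proof. by have := bochner_valP f; rewrite inE => -[]. Qed.

Lemma bochner_fun_fin (f : bochner_fun) :
  (fine (bochner_norm f))%:E = bochner_norm f.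
Proof.
have := bochner_valP f; rewrite inE => -[_ lf].
by rewrite fineK// ge0_fin_numE// Lnorm_ge0.
Qed.

Lemma eq_ae_bochner_norm f g : strongly_measurable f -> strongly_measurable g ->
  (\forall x \ae mu, f x = g x) -> bochner_norm f = bochner_norm g.
Proof.
move=> mf mg fg; rewrite !bochner_normE; congr poweR.
apply: ae_eq_integral => //.
- apply/measurable_EFinP; apply: (measurableT_comp (measurable_powR p)).
  exact: strongly_measurable_norm.
- apply/measurable_EFinP; apply: (measurableT_comp (measurable_powR p)).
  exact: strongly_measurable_norm.
by apply: filterS fg => x /= -> _.
Qed.

Lemma Lp_eqP (f g : bochner_fun) :
  \pi_Lp f = \pi_Lp g <-> \forall x \ae mu, f x = g x.
Proof.
have -> : (\forall x \ae mu, f x = g x) <-> (f - g \in null_pred).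
  rewrite inE /=; split; apply: filterS => x.
    by move=> fg; change (f x - g x = 0); rewrite fg subrr.
  by move=> fg; apply/eqP; rewrite -subr_eq0; apply/eqP.
rewrite Quotient.idealrBE; split => [->//|/eqP//].
Qed.

Lemma Lp_norm_pi (f : bochner_fun) : Lp_norm (\pi f) = fine (bochner_norm f).
Proof.
congr fine; apply: eq_ae_bochner_norm; [exact: bochner_fun_sm..|].
by apply/Lp_eqP; rewrite reprK.
Qed.

Lemma ler_Lp_normD F G : Lp_norm (F + G) <= Lp_norm F + Lp_norm G.
Proof.
rewrite -[F]reprK -[G]reprK; move: (repr F) (repr G) => f g.
rewrite -raddfD !Lp_norm_pi -lee_fin EFinD !bochner_fun_fin.
have -> : bochner_norm (f + g) = bochner_norm (f \- (- g : bochner_fun))%R.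
  by congr bochner_norm; apply/funext => x; exact: esym (congr1 _ (opprK _)).
rewrite -[bochner_norm g]bochner_normN.
by apply: (bochner_norm_triangle (g := - g)); exact: bochner_fun_sm.
Qed.

Lemma Lp_normMn F n : Lp_norm (F *+ n) = Lp_norm F *+ n.
Proof.
rewrite -[F]reprK; move: (repr F) => f.
rewrite -raddfMn !Lp_norm_pi; apply: EFin_inj.
rewrite bochner_fun_fin -mulr_natl EFinM bochner_fun_fin.
rewrite -[n%:R]normr_nat -bochner_normZ; last exact: bochner_fun_sm.
congr bochner_norm; apply/funext => x; rewrite scaler_nat.
by elim: n => [|n IH]; rewrite ?mulr0n// !mulrS -IH.
Qed.

Lemma Lp_normN F : Lp_norm (- F) = Lp_norm F.
Proof.
rewrite -[F]reprK; move: (repr F) => f.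
by rewrite -raddfN !Lp_norm_pi -[in RHS]bochner_normN.
Qed.

Lemma Lp_norm_eq0 F : Lp_norm F = 0 -> F = 0.
Proof.
rewrite -[F]reprK; move: (repr F) => f.
rewrite Lp_norm_pi => f0.
have nf0 : bochner_norm f = 0%E by rewrite -bochner_fun_fin f0.
rewrite -(raddf0 \pi_Lp); apply/Lp_eqP.
have p0 : (0 < p%:E)%E by rewrite lte_fin (lt_le_trans ltr01).
have mf : measurable_fun [set: T] (fun x => (`|f x|)%:E).
  exact/measurable_EFinP/strongly_measurable_norm/bochner_fun_sm.
apply: filterS (Lnorm_eq0_eq0 mf p0 nf0) => x /(_ I) [] /normr0_eq0.
by move=> ->.
Qed.

HB.instance Definition _ := GRing.Zmodule.on Lp.
HB.instance Definition _ := Num.Zmodule_isNormed.Build R Lp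
  ler_Lp_normD Lp_norm_eq0 Lp_normMn Lp_normN.

End bochner.

Arguments Lp {d T R} mu {p} p1 Y.

(* Lebesgue measure on [0, 1], seen as a measure on the real line that
   vanishes outside [0, 1]; up to a.e. equality, functions on [0, 1] are the
   same as functions on the line for this measure. *)
Definition lebesgue01 (R : realType) :
    {measure set (measurableTypeR R) -> \bar R} :=
  mrestr lebesgue_measure (measurable_itv (`[0, 1] : interval R)).

(* Main.v *)
Require Import Defs.
From mathcomp Require Import all_boot all_order all_algebra.
From mathcomp Require Import all_classical all_reals all_analysis.
From mathcomp Require Import measurable_realfun zify.
Import Order.TTheory GRing.Theory Num.Theory.
Import numFieldNormedType.Exports.
Set Implicit Arguments.
Unset Strict Implicit.
Unset Printing Implicit Defensive.
Local Open Scope classical_set_scope.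
Local Open Scope ring_scope.

(** A map h : nat -> bool of the indices of new vertices induces a 1-Lipschitz,
    height-preserving map D_k^omega -> D_k^2. Take h random, with the i-th value
    the i-th binary digit of a uniform point of [0, 1], and compose with the
    embedding of D_k^2 into Y, normalized to be 1-Lipschitz. On a vertical path
    the distance is the difference of the heights, so every h preserves it. Two
    vertices that are on no common vertical path sit in two copies i <> j of the
    pieces replacing one edge, and h preserves their distance as soon as
    h i <> h j, an event of probability 1/2: this costs the factor 2^(1/p). A
    single digit per index suffices, although the same index occurs at every
    level and edge, because only the place where the two vertices branch off
    matters. *)

(** * Walks and integer-valued graph distances *)

Inductive walk (G : graph) : vertex G -> vertex G -> nat -> Prop :=
| walk_nil x : walk x x 0
| walk_cons x y z n : Defs.adjacent x y -> walk y z n -> walk x z n.+1.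

Lemma adjacent_sym (G : graph) (x y : vertex G) : Defs.adjacent x y -> Defs.adjacent y x.
Proof. by move=> [e [[? ?]|[? ?]]]; exists e; [right|left]. Qed.

Lemma adjacent_edge (G : graph) (e : edge G) : Defs.adjacent (lower e) (upper e).
Proof. by exists e; left. Qed.

Lemma walk_cat (G : graph) (x y z : vertex G) m n :
  walk x y m -> walk y z n -> walk x z (m + n)%N.
Proof.
elim=> // x1 x2 x3 m' x12 _ IH /IH; exact: walk_cons.
Qed.

Lemma walk_adjacent (G : graph) (x y : vertex G) : Defs.adjacent x y -> walk x y 1.
Proof. by move=> xy; apply: walk_cons xy (walk_nil y). Qed.

Lemma walk_sym (G : graph) (x y : vertex G) n : walk x y n -> walk y x n.
Proof.
elim=> [z|x1 x2 x3 m x12 _ IH]; first exact: walk_nil.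
rewrite -addn1; apply: walk_cat IH _.
exact/walk_adjacent/adjacent_sym.
Qed.

Lemma path_walk (G : graph) (x : vertex G) s :
  path (@adjacentb G) x s -> walk x (last x s) (size s).
Proof.
elim: s x => [x _|y s IH x /= /andP[/asboolP xy /IH]]; first exact: walk_nil.
exact: walk_cons.
Qed.

Lemma walk_path (G : graph) (x y : vertex G) n : walk x y n ->
  exists s, [/\ path (@adjacentb G) x s, last x s = y & size s = n].
Proof.
elim=> [z|x1 x2 x3 m x12 _ [s [ps ls ss]]]; first by exists [::].
by exists (x2 :: s); split=> //=; rewrite ?ss// ps andbT; apply/asboolP.
Qed.

(** Pins down the infimum in [gdist] by a natural number, which can then be given by recursion on
    the construction of the graph. *)
Definition is_dist (G : graph) (D : vertex G -> vertex G -> nat) : Prop :=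
  (forall x y, walk x y (D x y)) /\ (forall x y n, walk x y n -> (D x y <= n)%N).

Lemma gdist_is_dist (R : realType) (G : graph) (D : vertex G -> vertex G -> nat)
    (x y : vertex G) : is_dist D -> gdist R x y = (D x y)%:R.
Proof.
move=> [Dw Dm]; apply/eqP; rewrite eq_le; apply/andP; split.
  have [s [ps ls ss]] := walk_path (Dw x y).
  apply: ge_inf; last by exists s => //; rewrite ss.
  by exists 0 => _ [t _ <-].
apply: lb_le_inf.
  have [s [ps ls ss]] := walk_path (Dw x y).
  by exists (size s)%:R; exists s.
move=> _ [t [pt lt] <-]; rewrite ler_nat; apply: Dm.
by rewrite -lt; exact: path_walk.
Qed.

Section is_dist_theory.
Context (G : graph) (D : vertex G -> vertex G -> nat) (HD : is_dist D).

Lemma is_dist_refl x : D x x = 0%N.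
Proof. by apply/eqP; rewrite -leqn0; apply: HD.2; exact: walk_nil. Qed.

Lemma is_dist_eq0 x y : D x y = 0%N -> x = y.
Proof. by move=> D0; have := HD.1 x y; rewrite D0 => w; inversion w. Qed.

Lemma is_dist_sym x y : D x y = D y x.
Proof.
by apply/eqP; rewrite eqn_leq; apply/andP; split; apply/HD.2/walk_sym/HD.1.
Qed.

Lemma is_dist_triangle x y z : (D x z <= D x y + D y z)%N.
Proof. by apply/HD.2/(walk_cat (HD.1 _ _))/HD.1. Qed.

Lemma is_dist_adjacent x y z : Defs.adjacent x y -> (D x z <= (D y z).+1)%N.
Proof. by move=> xy; apply/HD.2/(walk_cons xy)/HD.1. Qed.

Lemma is_dist_edge e z : (D (lower e) z <= (D (upper e) z).+1)%N /\
  (D (upper e) z <= (D (lower e) z).+1)%N.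
Proof.
by split; apply: is_dist_adjacent; [|apply: adjacent_sym]; exact: adjacent_edge.
Qed.

Lemma is_dist_edge1 e : lower e <> upper e -> D (lower e) (upper e) = 1%N.
Proof.
move=> lu; have := (is_dist_edge e (upper e)).1.
rewrite is_dist_refl; case E : (D _ _) => [|[|n]]// _.
by case: lu; exact: is_dist_eq0.
Qed.

End is_dist_theory.

(** The bound from below on walk lengths is local: the distance to a fixed target drops by at most
    one along each edge and is 0 at the target. *)
Lemma is_dist_of_lipschitz (G : graph) (D : vertex G -> vertex G -> nat) :
  (forall x y, walk x y (D x y)) -> (forall x, D x x = 0%N) ->
  (forall e z, (D (lower e) z <= (D (upper e) z).+1)%N /\
    (D (upper e) z <= (D (lower e) z).+1)%N) ->
  is_dist D.
Proof.
move=> Dw D0 De; split=> // x y n.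
elim=> [z|x1 x2 x3 m [e [[<- <-]|[<- <-]]] _ IH]; first by rewrite D0.
- exact: leq_trans (De e x3).1 _.
- exact: leq_trans (De e x3).2 _.
Qed.

(** * Distances after a subdivision and in diamond graphs *)

Definition endpoint (H : graph) (e : edge H) (b : bool) : vertex H :=
  if b then upper e else lower e.

Section subdivide_distance.
Context (I : Type) (G : graph).

Definition dist_to_edge (D : vertex G -> vertex G -> nat) x (e : edge G) :=
  minn (D x (lower e)) (D x (upper e)).

Definition dist_edges (D : vertex G -> vertex G -> nat) (e f : edge G) :=
  minn (dist_to_edge D (lower e) f) (dist_to_edge D (upper e) f).

(** Old distances double. A new vertex has only the endpoints of its edge as neighbours, so it adds
    one step to the doubled distance from the nearer endpoint. *)
Definition subdivide_dist (D : vertex G -> vertex G -> nat)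
    (x y : vertex (subdivide I G)) : nat :=
  match x, y with
  | inl u, inl v => (D u v).*2
  | inl u, inr (f, _) => (dist_to_edge D u f).*2.+1
  | inr (e, _), inl v => (dist_to_edge D v e).*2.+1
  | inr ei, inr fj =>
    if `[< ei = fj >] then 0%N else (dist_edges D ei.1 fj.1).*2.+2
  end.

Lemma adjacent_subdivide (e : edge G) (i : I) b :
  @Defs.adjacent (subdivide I G) (inl (endpoint e b)) (inr (e, i)).
Proof. by exists (e, i, b); case: b; [right|left]. Qed.

(** Each old edge becomes a two-step detour through its copy [i0]; with [I] empty, no edge would be
    left. *)
Lemma walk_subdivide (i0 : I) (x y : vertex G) n : walk x y n ->
  @walk (subdivide I G) (inl x) (inl y) n.*2.
Proof.
elim=> [z|x1 x2 x3 m [e xe] _ IH]; first exact: walk_nil.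
suff [b [-> Eb]] : exists b, x1 = endpoint e b /\ x2 = endpoint e (~~ b).
  apply: (walk_cons (adjacent_subdivide e i0 b)).
  apply: (walk_cons _ IH); rewrite Eb.
  exact/adjacent_sym/adjacent_subdivide.
by case: xe => -[<- <-]; [exists false|exists true].
Qed.

Lemma dist_to_edgeP D x e : exists b, dist_to_edge D x e = D x (endpoint e b).
Proof.
rewrite /dist_to_edge; case: (leqP (D x (lower e)) (D x (upper e))) => _.
  by exists false.
by exists true.
Qed.

Lemma dist_edgesP D e f : exists a b,
  dist_edges D e f = D (endpoint e a) (endpoint f b).
Proof.
rewrite /dist_edges; case: leqP => _.
  by have [b ->] := dist_to_edgeP D (lower e) f; exists false, b.
by have [b ->] := dist_to_edgeP D (upper e) f; exists true, b.
Qed.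

Lemma subdivide_is_dist (i0 : I) D : is_dist D -> is_dist (subdivide_dist D).
Proof.
move=> HD; apply: is_dist_of_lipschitz.
- have wlr u f j : @walk (subdivide I G) (inl u) (inr (f, j))
      (dist_to_edge D u f).*2.+1.
    have [b ->] := dist_to_edgeP D u f; rewrite -addn1.
    apply: walk_cat (walk_subdivide i0 (HD.1 _ _)) _.
    exact/walk_adjacent/adjacent_subdivide.
  move=> [u|[e i]] [v|[f j]] /=.
  + exact/walk_subdivide/HD.1.
  + exact: wlr.
  + exact/walk_sym/wlr.
  + case: asboolP => [->|_]; first exact: walk_nil.
    have [a [b ->]] := dist_edgesP D e f; rewrite -addn1.
    apply: (@walk_cat (subdivide I G) _ (inl (endpoint f b))); last first.
      exact/walk_adjacent/adjacent_subdivide.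
    apply: walk_cons (walk_subdivide i0 (HD.1 _ _)).
    exact/adjacent_sym/adjacent_subdivide.
- move=> [u|[e i]] /=; first by rewrite is_dist_refl.
  by case: asboolP.
- move=> [[e i] b] [v|[f j]].
    have := is_dist_edge HD e v; have sym := is_dist_sym HD v.
    by case: b; rewrite /= /dist_to_edge !sym; lia.
  (* For distinct new vertices, the minimum over both endpoints of [e] is at most one below the
     value at either, so doubled values with their extra steps differ by one. Zero self-distances
     settle the case of equal ones. *)
  have := is_dist_edge HD e (lower f); have := is_dist_edge HD e (upper f).
  have Dl := is_dist_refl HD (lower f); have Du := is_dist_refl HD (upper f).
  case: b => /=; case: asboolP => [[-> _]|_];
    by rewrite /dist_edges /dist_to_edge; lia.
Qed.

End subdivide_distance.

Fixpoint diamond_dist (I : Type) (k : nat) :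
    vertex (diamond I k) -> vertex (diamond I k) -> nat :=
  match k with
  | 0 => fun x y : bool => nat_of_bool (x != y)
  | k'.+1 => @subdivide_dist I (diamond I k') (@diamond_dist I k')
  end.

Lemma diamond_is_dist (I : Type) (i0 : I) k : is_dist (@diamond_dist I k).
Proof.
elim: k => [|k IH] /=; last exact: (subdivide_is_dist i0 IH).
apply: is_dist_of_lipschitz; last by move=> [] [].
- have E := @adjacent_edge single_edge tt.
  move=> [] [] /=; try exact: walk_nil.
  + exact/walk_adjacent/adjacent_sym.
  + exact: walk_adjacent.
- by move=> x; rewrite eqxx.
Qed.

Lemma diamond_dist_edge (I : Type) (i0 : I) k (e : edge (diamond I k)) :
  diamond_dist (lower e) (upper e) = 1%N.
Proof.
apply: (is_dist_edge1 (diamond_is_dist i0 k)).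
by case: k e => [|k] //= [[e i] []].
Qed.

(** After a subdivision exactly one endpoint of an edge is new: it names the old edge and the copy,
    and its position as lower or upper end names the half. *)
Lemma diamond_simple (I : Type) k (e f : edge (diamond I k)) :
  lower e = lower f -> upper e = upper f -> e = f.
Proof.
case: k e f => [[] []//|k] [[e i] a] [[f j] b] /=.
by case: a; case: b => //= -[]; do ?[by move=> -> ->|move=> _ [->  ->]].
Qed.

(** * Maps of diamond graphs induced by maps of indices *)

Section subdivide_map.
Context (I J : Type) (h : I -> J) (G H : graph).
Context (fv : vertex G -> vertex H) (fe : edge G -> edge H).

Definition subdivide_vmap (x : vertex (subdivide I G)) :
    vertex (subdivide J H) :=
  match x with inl v => inl (fv v) | inr (e, i) => inr (fe e, h i) end.

Definition subdivide_emap (e : edge (subdivide I G)) : edge (subdivide J H) :=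
  (fe e.1.1, h e.1.2, e.2).

End subdivide_map.

Fixpoint diamond_emap (I J : Type) (h : I -> J) k :
    edge (diamond I k) -> edge (diamond J k) :=
  match k with
  | 0 => id
  | k'.+1 => @subdivide_emap I J h (diamond I k') (diamond J k')
                (@diamond_emap I J h k')
  end.

Fixpoint diamond_vmap (I J : Type) (h : I -> J) k :
    vertex (diamond I k) -> vertex (diamond J k) :=
  match k with
  | 0 => id
  | k'.+1 => @subdivide_vmap I J h (diamond I k') (diamond J k')
                (@diamond_vmap I J h k') (@diamond_emap I J h k')
  end.

Section diamond_map.
Context (I J : Type) (i0 : I) (j0 : J).
Implicit Types (h : I -> J).

Lemma endpoint_map h k (e : edge (diamond I k)) b :
  endpoint (diamond_emap h e) b = diamond_vmap h (endpoint e b).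
Proof.
elim: k e b => [|k IH]; first by move=> e [].
move=> [[e i] a] b.
case: a; case: b => //=; [have := IH e true|have := IH e false]; by move=> /= ->.
Qed.

Lemma lower_map h k (e : edge (diamond I k)) :
  lower (diamond_emap h e) = diamond_vmap h (lower e).
Proof. exact: (endpoint_map h e false). Qed.

Lemma upper_map h k (e : edge (diamond I k)) :
  upper (diamond_emap h e) = diamond_vmap h (upper e).
Proof. exact: (endpoint_map h e true). Qed.

Lemma bottom_map h k :
  diamond_vmap h (Defs.bottom (diamond I k)) = Defs.bottom (diamond J k).
Proof. by elim: k => //= k ->. Qed.

Lemma walk_map h k (x y : vertex (diamond I k)) n : walk x y n ->
  walk (diamond_vmap h x) (diamond_vmap h y) n.
Proof.
elim=> [z|x1 x2 x3 m [e xe] _ IH]; first exact: walk_nil.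
apply: walk_cons IH; exists (diamond_emap h e); rewrite lower_map upper_map.
by case: xe => -[<- <-]; [left|right].
Qed.

Lemma diamond_dist_map_le h k (x y : vertex (diamond I k)) :
  (diamond_dist (diamond_vmap h x) (diamond_vmap h y) <= diamond_dist x y)%N.
Proof. exact/(diamond_is_dist j0 k).2/walk_map/(diamond_is_dist i0 k).1. Qed.

Lemma height_map h k (x : vertex (diamond I k)) :
  diamond_dist (Defs.bottom _) (diamond_vmap h x) = diamond_dist (Defs.bottom _) x.
Proof.
elim: k x => [//|k IH] [v|[e i]] /=; first by rewrite IH.
by rewrite /dist_to_edge lower_map upper_map !IH.
Qed.

(** Links the naming of endpoints to the metric: an increasing path can only cross edges from
    [lower] to [upper]. *)
Lemma height_edge k (e : edge (diamond I k)) :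
  diamond_dist (Defs.bottom _) (upper e) = (diamond_dist (Defs.bottom _) (lower e)).+1.
Proof.
elim: k e => [//|k IH] [[e i] b]; case: b => /=;
  by have := IH e; rewrite /dist_to_edge; lia.
Qed.

(** An increasing path gains one unit of height per edge, so its length is a difference of heights.
    Heights survive [h], and by the triangle inequality from the bottom the image distance is at
    least that difference. *)
Lemma same_vertical_path_dist (R : realType) k (x y : vertex (diamond I k)) :
  same_vertical_path R x y ->
  forall h, diamond_dist (diamond_vmap h x) (diamond_vmap h y) = diamond_dist x y.
Proof.
have DI := diamond_is_dist i0 k; have DJ := diamond_is_dist j0 k.
suff inc (u v : vertex (diamond I k)) h : increasing_path R u v ->
    diamond_dist (diamond_vmap h u) (diamond_vmap h v) = diamond_dist u v.
  move=> [xy|yx] h; first exact: inc xy.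
  by rewrite is_dist_sym// (is_dist_sym DI) inc.
move=> [s [ps ls]].
have [ws hs] : walk u v (size s) /\
    (diamond_dist (Defs.bottom _) u + size s = diamond_dist (Defs.bottom _) v)%N.
  elim: s u ps ls => [u _ /= <-|w s IH u /= /andP[/andP[/asboolP uw]]].
    by rewrite addn0; split=> //; exact: walk_nil.
  rewrite !(gdist_is_dist R _ _ DI) ltr_nat => huw ps ls.
  have [ws hs] := IH _ ps ls; split; first exact: walk_cons uw ws.
  rewrite -hs addnS -addSn; congr addn.
  case: uw huw => e [[<- <-]|[<- <-]]; rewrite height_edge//; lia.
apply/eqP; rewrite eqn_leq diamond_dist_map_le/=.
apply: leq_trans (DI.2 _ _ _ ws) _.
have := is_dist_triangle DJ (Defs.bottom _) (diamond_vmap h u) (diamond_vmap h v).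
by rewrite !height_map; lia.
Qed.

(* If e and f lie in different copies i, j of the pieces that replace a common
   ancestor edge, distances between their endpoints survive as soon as h
   separates i from j; otherwise they survive under every h. *)
Lemma edge_separation k (e f : edge (diamond I k)) :
  exists P : (I -> J) -> Prop,
    (P = (fun=> True) \/ exists i j, i <> j /\ P = (fun h => h i <> h j)) /\
    forall h, P h -> forall a b,
      diamond_dist (diamond_vmap h (endpoint e a)) (diamond_vmap h (endpoint f b))
      = diamond_dist (endpoint e a) (endpoint f b).
Proof.
elim: k e f => [|k IH]; first by move=> e f; exists (fun=> True); split; [left|].
have DI := diamond_is_dist i0 k; have DJ := diamond_is_dist j0 k.
move=> [[e i] a'] [[f j] b'].
have endE (L : Type) (K : graph) (c d : edge K * L * bool) a :
    @endpoint (subdivide L K) c a =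
    if a == c.2 then inl (endpoint c.1.1 c.2) else inr c.1.
  by case: c => [[? ?] []]; case: a.
(* The induction step needs one more fact: two new vertices on the same edge stay apart only if [h]
   separates their indices. *)
suff [P [PS PG]] : exists P : (I -> J) -> Prop,
    (P = (fun=> True) \/ exists i j, i <> j /\ P = (fun h => h i <> h j)) /\
    forall h, P h ->
    (forall a b, diamond_dist (diamond_vmap h (endpoint e a))
        (diamond_vmap h (endpoint f b)) =
      diamond_dist (endpoint e a) (endpoint f b)) /\
    (e = f -> i <> j -> h i <> h j).
  exists P; split=> // h /PG [gh hij] a b {PS PG}.
  (* Equal image edges have endpoints at distance 0, and [gh] pulls this back to [e] and [f]. *)
  have eqf : diamond_emap h e = diamond_emap h f -> e = f.
    move=> E; have ends c : endpoint e c = endpoint f c.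
      apply: (is_dist_eq0 DI); rewrite -gh -!endpoint_map E.
      exact: (is_dist_refl DJ).
    exact: diamond_simple (ends false) (ends true).
  have ll := gh false false; have lu := gh false true.
  have ul := gh true false; have uu := gh true true.
  rewrite /= in ll lu ul uu.
  (* Each of the two endpoints is an old vertex or the new one, which gives four cases. *)
  rewrite !(endE I (diamond I k))//=; case: (a == a'); case: (b == b') => /=.
  - by rewrite gh.
  - have := gh a' false; have := gh a' true => /= g1 g2.
    by rewrite /dist_to_edge lower_map upper_map g1 g2.
  - have := gh false b'; have := gh true b' => /= g1 g2.
    rewrite /dist_to_edge lower_map upper_map.
    by rewrite !(is_dist_sym DJ (diamond_vmap h (endpoint f b'))) g1 g2
      !(is_dist_sym DI (endpoint f b')).
  - case: (asboolP ((e, i) = (f, j))) => [[-> ->]|eifj].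
      by case: asboolP.
    (* Equal images of distinct new vertices would force [e = f], hence [i <> j], and then [hij]
       separates the images. *)
    case: asboolP => [[/eqf ef hh]|_].
      by case: (hij ef) => // ij; apply: eifj; rewrite ef ij.
    by rewrite /dist_edges /dist_to_edge !lower_map !upper_map ll lu ul uu.
(* For distinct [e] and [f] the condition is inherited and the extra clause is vacuous. For [e = f]
   every [h] keeps the endpoint distances, which are 0 or 1; here the condition [h i <> h j]
   enters. *)
have [ef|nef] := pselect (e = f); last first.
  by have [P [PS PG]] := IH e f; exists P; split=> // h /PG.
subst f; have self h a b : diamond_dist (diamond_vmap h (endpoint e a))
    (diamond_vmap h (endpoint e b)) = diamond_dist (endpoint e a) (endpoint e b).
  have DJ1 := diamond_dist_edge j0 (diamond_emap h e).
  have DI1 := diamond_dist_edge i0 e.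
  rewrite lower_map upper_map in DJ1.
  case: a; case: b; rewrite /= ?(is_dist_refl DI) ?(is_dist_refl DJ) ?DI1 ?DJ1//.
  by rewrite (is_dist_sym DI) (is_dist_sym DJ) DI1 DJ1.
have [ij|nij] := pselect (i = j).
  by exists (fun=> True); split; [left|].
by exists (fun h => h i <> h j); split=> //; right; exists i, j.
Qed.

(** Reduces pairs of vertices to pairs of edges, on which the induction of [edge_separation]
    runs. *)
Lemma vertex_endpoint k (x : vertex (diamond I k)) :
  exists e b, x = endpoint e b.
Proof.
elim: k x => [|k IH] => [b|[v|[e i]]]; first by exists tt, b; case: b.
  have [e [b ->]] := IH v; exists (e, i0, b), b; by case: b.
by exists (e, i, false), true.
Qed.

Lemma diamond_dist_map_eq (k : nat) (x y : vertex (diamond I k)) :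
  (forall h, diamond_dist (diamond_vmap h x) (diamond_vmap h y) =
    diamond_dist x y) \/
  exists i j, i <> j /\ forall h, h i <> h j ->
    diamond_dist (diamond_vmap h x) (diamond_vmap h y) = diamond_dist x y.
Proof.
have [e [a ->]] := vertex_endpoint x; have [f [b ->]] := vertex_endpoint y.
have [P [[->|[i [j [ij ->]]]] PG]] := edge_separation e f.
  by left=> h; exact: PG.
by right; exists i, j; split=> // h hij; exact: PG.
Qed.

End diamond_map.

(** * Measurable functions with finitely many values *)

Section discrete_functions.
Context d (T : measurableType d).

(** [simple_fun] with an arbitrary codomain: random points pass through vertices and edges of
    diamond graphs before they reach [Y]. *)
Definition discrete_fun (Z : Type) (f : T -> Z) : Prop :=
  finite_set (range f) /\ forall z, measurable (f @^-1` [set z]).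

Lemma discrete_fun_cst (Z : Type) (z : Z) : discrete_fun (fun=> z).
Proof.
split=> [|y]; first by apply: (@sub_finite_set _ _ [set z]) => // _ [x _ <-].
rewrite preimage_cst; case: ifP => _; [exact: measurableT|exact: measurable0].
Qed.

Lemma discrete_fun_comp2 (Z1 Z2 Z : Type) (op : Z1 -> Z2 -> Z) f g :
  discrete_fun f -> discrete_fun g -> discrete_fun (fun x => op (f x) (g x)).
Proof.
move=> [ff mf] [fg mg]; split.
  apply: (@sub_finite_set _ _ ((fun z => op z.1 z.2) @` (range f `*` range g))).
    by move=> _ [x _ <-]; exists (f x, g x) => //; split; exists x.
  exact/finite_image/finite_setX.
move=> y; set F := (X in measurable X).
pose P := (range f `*` range g) `&` [set z | op z.1 z.2 = y].
have -> : F = \bigcup_(z in P) (f @^-1` [set z.1] `&` g @^-1` [set z.2]).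
  apply/seteqP; split => [x Fx|x [z [_ zy] [/= fz gz]]].
    by exists (f x, g x) => //; do 2?[split => //]; exists x.
  by rewrite /F/= fz gz.
apply: fin_bigcup_measurable => [|z _]; last exact: measurableI.
by apply: finite_setIl; exact: finite_setX.
Qed.

Lemma discrete_fun_comp (Z1 Z : Type) (h : Z1 -> Z) f :
  discrete_fun f -> discrete_fun (h \o f).
Proof.
move=> df; exact: (discrete_fun_comp2 (fun z _ => h z) df (discrete_fun_cst tt)).
Qed.

Lemma discrete_fun_bool (A : set T) : measurable A ->
  discrete_fun (fun x => `[< A x >]).
Proof.
move=> mA; split; first exact: finite_finset.
move=> [].
  rewrite (_ : _ @^-1` _ = A)//.
  by apply/seteqP; split=> x /=; [move/asboolP|move=> ?; apply/asboolP].
rewrite (_ : _ @^-1` _ = ~` A); first exact: measurableC.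
by apply/seteqP; split=> x /=; [move/asboolPn|move=> ?; apply/asboolPn].
Qed.

Lemma simple_strongly_measurable (R : realType) (Y : normedModType R)
  (f : T -> Y) : simple_fun f -> strongly_measurable f.
Proof.
by move=> sf; exists (fun=> f); split=> // x; exact: cvg_cst.
Qed.

End discrete_functions.

(** * Bounds on Bochner norms *)

Section bochner_bounds.
Context d (T : measurableType d) (R : realType).
Context (mu : {measure set T -> \bar R}) (p : R) (p1 : 1 <= p).
Context (Y : normedModType R).

Lemma bochner_norm_le (f : T -> Y) (c : R) : strongly_measurable f ->
  mu [set: T] = 1%E -> 0 <= c -> (forall x, `|f x| <= c) ->
  (bochner_norm mu p f <= c%:E)%E.
Proof.
move=> mf mu1 c0 fc; have p0 : 0 < p by exact: lt_le_trans p1.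
rewrite bochner_normE.
have -> : c%:E = poweR (\int[mu]_(x in [set: T]) (c `^ p)%:E)%E p^-1.
  have /= -> := integral_cst mu measurableT (c `^ p)%:E.
  by rewrite mu1 mule1 poweR_EFin -powRrM mulfV ?gt_eqF// powRr1.
apply: gt0_ler_poweR; rewrite ?invr_ge0 ?(ltW p0)//.
- by rewrite in_itv/= leey andbT integral_ge0// => x _; rewrite lee_fin powR_ge0.
- by rewrite in_itv/= leey andbT integral_ge0// => x _; rewrite lee_fin powR_ge0.
apply: ge0_le_integral => //.
- apply/measurable_EFinP; apply: (measurableT_comp (measurable_powR p)).
  exact: strongly_measurable_norm.
- by move=> x _; rewrite lee_fin ge0_ler_powR ?nnegrE ?(ltW p0).
Qed.

(** Markov's inequality for the power [p]: only the integral over [A] is kept. With [m] equal to 1/2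
    this is the source of the factor 2^(1/p). *)
Lemma bochner_norm_ge (f : T -> Y) (c : R) (A : set T) (m : R) :
  strongly_measurable f -> measurable A -> 0 <= m -> (m%:E <= mu A)%E ->
  0 <= c -> (forall x, A x -> c <= `|f x|) ->
  ((m `^ p^-1 * c)%:E <= bochner_norm mu p f)%E.
Proof.
move=> mf mA m0 mAm c0 fc; have p0 : 0 < p by exact: lt_le_trans p1.
have mfp : measurable_fun [set: T] (fun x => (`|f x| `^ p)%:E).
  apply/measurable_EFinP; apply: (measurableT_comp (measurable_powR p)).
  exact: strongly_measurable_norm.
rewrite bochner_normE.
have -> : (m `^ p^-1 * c)%:E = poweR (m%:E * (c `^ p)%:E)%E p^-1.
  by rewrite -EFinM poweR_EFin powRM ?powR_ge0// -powRrM mulfV ?gt_eqF// powRr1.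
apply: gt0_ler_poweR; rewrite ?invr_ge0 ?(ltW p0)//.
- by rewrite in_itv/= leey andbT mule_ge0 ?lee_fin ?powR_ge0.
- by rewrite in_itv/= leey andbT integral_ge0// => x _; rewrite lee_fin powR_ge0.
apply: (@le_trans _ _ (\int[mu]_(x in A) (c `^ p)%:E)%E).
  have /= -> := integral_cst mu mA (c `^ p)%:E.
  by rewrite muleC; apply: lee_wpmul2l => //; rewrite lee_fin powR_ge0.
apply: (@le_trans _ _ (\int[mu]_(x in A) (`|f x| `^ p)%:E)%E).
  apply: ge0_le_integral => //.
  - by move=> x _; rewrite lee_fin powR_ge0.
  - exact: measurable_funTS.
  - by move=> x Ax; rewrite lee_fin ge0_ler_powR ?nnegrE ?(ltW p0) ?fc.
by apply: ge0_subset_integral => // x _; rewrite lee_fin powR_ge0.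
Qed.

End bochner_bounds.

(** * Binary digits under Lebesgue measure on [0, 1] *)

Section dyadic_bits.
Context (R : realType).

(** Half-open, so that the index of an interval containing [x] is the integer part of [x * N]. *)
Definition level_set (N q : nat) : set R :=
  [set x | q%:R / N%:R <= x < q.+1%:R / N%:R].

Lemma level_setE N q : level_set N q = [set` `[q%:R / N%:R, q.+1%:R / N%:R[ ].
Proof. by apply/seteqP; split=> x; rewrite /level_set /= in_itv. Qed.

(* [2 ^ i.+1] intervals partition [0, 1), and bit i is the parity of the index. *)
Definition bit_set (i : nat) : set R :=
  \bigcup_(q in [set q | odd q]) level_set (2 ^ i.+1) q.

Definition bit (x : R) (i : nat) : bool := `[< bit_set i x >].

Lemma level_setP N q x : (0 < N)%N ->
  level_set N q x <-> q%:R <= x * N%:R < q.+1%:R.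
Proof.
by move=> N0; rewrite /level_set /= ler_pdivrMr ?ltr_pdivlMr// ltr0n.
Qed.

Lemma level_set_inj N q q' x : (0 < N)%N ->
  level_set N q x -> level_set N q' x -> q = q'.
Proof.
move=> N0 /(level_setP _ _ N0) H /(level_setP _ _ N0) H'.
by rewrite -(truncn_def H) (truncn_def H').
Qed.

Lemma level_set_coarse N d q x : (0 < N)%N -> (0 < d)%N ->
  level_set (N * d) q x -> level_set N (q %/ d) x.
Proof.
move=> N0 d0; have d0' : 0 < d%:R :> R by rewrite ltr0n.
rewrite !level_setP ?muln_gt0 ?N0// natrM mulrA => /andP[lq uq].
apply/andP; split.
  rewrite -(ler_pM2r d0') (le_trans _ lq)// -natrM ler_nat; exact: leq_trunc_div.
rewrite -(ltr_pM2r d0') (lt_le_trans uq)// -natrM ler_nat ltn_ceil//.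
Qed.

Lemma bit_level (i q : nat) x : level_set (2 ^ i.+1) q x -> bit x i = odd q.
Proof.
move=> xq; apply/asboolP/idP => [[q' /= oq' xq']|oq]; last by exists q.
by rewrite (level_set_inj _ xq xq')// expn_gt0.
Qed.

(** Passing from digit [j] to digit [i] drops the last [j - i] binary digits of the index. *)
Lemma bit_coarse (i j q : nat) x : (i <= j)%N -> level_set (2 ^ j.+1) q x ->
  bit x i = odd (q %/ 2 ^ (j - i)).
Proof.
move=> ij xq; apply: bit_level; apply: level_set_coarse; rewrite ?expn_gt0//.
by rewrite -expnD addSn subnKC.
Qed.

Lemma measurable_level_set N q :
  measurable (level_set N q : set (measurableTypeR R)).
Proof. by rewrite level_setE; exact: measurable_itv. Qed.

Lemma measurable_bit_set i : measurable (bit_set i : set (measurableTypeR R)).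
Proof. by apply: bigcup_measurable => q _; exact: measurable_level_set. Qed.

Lemma discrete_bit i :
  discrete_fun (fun x : measurableTypeR R => bit x i).
Proof. by apply: discrete_fun_bool; exact: measurable_bit_set. Qed.

Lemma lebesgue01_setT : lebesgue01 R [set: R] = 1%E.
Proof.
rewrite /lebesgue01 /= /mrestr. rewrite setTI lebesgue_measure_itv /= lte_fin ltr01.
by rewrite sube0.
Qed.

Lemma lebesgue01_level_set N q : (0 < N)%N -> (q < N)%N ->
  lebesgue01 R (level_set N q) = (N%:R^-1)%:E.
Proof.
move=> N0 qN; have N0' : 0 < N%:R :> R by rewrite ltr0n.
(* As [q < N], the interval lies inside [0, 1] and the restriction of the measure does not cut
   it. *)
rewrite /lebesgue01 /= /mrestr setIidl; last first.
  move=> x /(level_setP _ _ N0) /andP[lq uq] /=; rewrite in_itv /=.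
  rewrite -(ler_pM2r N0') mul0r (le_trans _ lq)//=.
  by rewrite -(ler_pM2r N0') mul1r (le_trans (ltW uq))// ler_nat.
rewrite level_setE lebesgue_measure_itv /= lte_fin ltr_pM2r ?invr_gt0// ltr_nat.
by rewrite ltnSn -EFinB -mulrBl -natrB// subSnn mul1r.
Qed.

Definition bits_differ (i j : nat) : set (measurableTypeR R) :=
  [set x | bit x i <> bit x j].

Lemma measurable_bits_differ i j : measurable (bits_differ i j).
Proof.
have [_ /(_ true)] := discrete_fun_comp2 (fun a b : bool => a != b)
  (discrete_bit i) (discrete_bit j).
congr measurable; apply/seteqP.
by split=> x /=; [move=> /eqP|move=> /eqP].
Qed.

(* On the m-th interval of length 2^-j bit i is constant, and bit j is zero on
   the left half and one on the right half. *)
Lemma lebesgue01_bits_differ i j : i <> j ->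
  ((2^-1)%:E <= lebesgue01 R (bits_differ i j))%E.
Proof.
wlog ij : i j / (i < j)%N.
  move=> wl nij; case: (ltngtP i j) => // lij; [exact: wl|].
  rewrite (_ : bits_differ i j = bits_differ j i); first exact: (wl _ _ lij (nesym nij)).
  by apply/seteqP; split=> x /= /nesym.
(* Of the two halves 2m and 2m + 1, [q m] is the one where bit [j] is opposite to bit [i]. The 2^j
   chosen halves have length 2^-(j+1) each, in total 1/2. *)
move=> _; pose q m := (m.*2 + ~~ odd (m.*2 %/ 2 ^ (j - i)))%N.
pose U : set (measurableTypeR R) :=
  \bigcup_(m in `I_(2 ^ j)) level_set (2 ^ j.+1) (q m).
have sub : U `<=` bits_differ i j.
  move=> x [m /= mj xm].
  rewrite /bits_differ /= (bit_level xm) (bit_coarse (ltnW ij) xm).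
  have -> : (q m %/ 2 ^ (j - i) = m.*2 %/ 2 ^ (j - i))%N.
    (* As [i < j], the quotient starts with a division by 2, which absorbs the last digit of
       [q m]. *)
    have [r ->] : exists r, (j - i = r.+1)%N by exists (j - i).-1; lia.
    by rewrite expnS !divnMA /q; congr (_ %/ _)%N; case: odd => /=; lia.
  by rewrite /q oddD odd_double; case: odd.
apply: (@le_trans _ _ (lebesgue01 R U)); last first.
  apply: le_measure sub; rewrite inE; last exact: measurable_bits_differ.
  by apply: bigcup_measurable => m _; exact: measurable_level_set.
have qlt m : (m < 2 ^ j -> q m < 2 ^ j.+1)%N.
  by rewrite expnS /q; case: odd => /=; lia.
rewrite measure_fin_bigcup//=; first last.
- by move=> m _; exact: measurable_level_set.
- apply/trivIsetP => m m' _ _ mm'; apply/seteqP; split=> // x [xm xm'].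
  have := level_set_inj _ xm xm'; rewrite expn_gt0 => /(_ isT) qq.
  case/eqP: mm'; move: qq; rewrite /q; case: odd; case: odd => /=; lia.
rewrite (eq_fsbigr (fun=> ((2 ^ j.+1)%:R^-1)%:E)); last first.
  by move=> m /[!inE] /= mj; apply: lebesgue01_level_set; rewrite ?expn_gt0// qlt.
rewrite -fsbig_ord sumEFin big_const_ord iter_addr_0 lee_fin expnS natrM.
by rewrite -(mulr_natr (_^-1)) invfM -mulrA mulVf ?mulr1// pnatr_eq0 expn_eq0.
Qed.

End dyadic_bits.

(** * The random embedding into the Bochner space *)

Section random_embedding.
Context (R : realType) (p : R) (p1 : 1 <= p) (Y : normedModType R) (k : nat).
Implicit Types (x y : vertex (diamond nat k)).

(** The image of a fixed edge depends on finitely many binary digits only; this makes the random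
    maps simple functions. *)
Lemma discrete_diamond_emap j (e : edge (diamond nat j)) :
  discrete_fun (fun w : measurableTypeR R => diamond_emap (bit w) e).
Proof.
elim: j e => [|j IH] e; first exact: discrete_fun_cst.
case: e => [[e i] b].
exact: (discrete_fun_comp2 (fun e' i' => (e', i', b)) (IH e) (discrete_bit R i)).
Qed.

Lemma discrete_diamond_vmap j (x : vertex (diamond nat j)) :
  discrete_fun (fun w : measurableTypeR R => diamond_vmap (bit w) x).
Proof.
elim: j x => [|j IH] x; first exact: discrete_fun_cst.
case: x => [v|[e i]].
  exact: (discrete_fun_comp inl (IH v)).
exact: (discrete_fun_comp2 (fun e' i' => inr (e', i'))
  (discrete_diamond_emap e) (discrete_bit R i)).
Qed.

Context (C : R) (C1 : 1 <= C) (f : vertex (diamond bool k) -> Y).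
Hypothesis f_lower : forall u v,
  C^-1 * (diamond_dist u v)%:R <= `|f u - f v|.
Hypothesis f_upper : forall u v, `|f u - f v| <= (diamond_dist u v)%:R.

Definition random_map x (w : measurableTypeR R) : Y :=
  f (diamond_vmap (bit w) x).

Lemma simple_random_map x : simple_fun (random_map x).
Proof. exact: (discrete_fun_comp f (discrete_diamond_vmap x)). Qed.

Lemma random_map_bochner x :
  random_map x \in @bochner_pred _ _ R (lebesgue01 R) p Y.
Proof.
have sx := simple_strongly_measurable (simple_random_map x).
rewrite inE; split=> //.
(* Every induced map sends bottom to bottom, so the Lipschitz bound keeps all values within a fixed
   distance of one vector. *)
pose b := Defs.bottom (diamond nat k).
apply: (@le_lt_trans _ _ (`|f (Defs.bottom _)| + (diamond_dist x b)%:R)%:E);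
  last exact: ltry.
apply: bochner_norm_le => //; first exact: lebesgue01_setT.
move=> w; rewrite -(bottom_map (bit w)).
rewrite -[random_map x w](subrK (f (diamond_vmap (bit w) b))) addrC.
apply: le_trans (ler_normD _ _) _; rewrite lerD2l.
by rewrite (le_trans (f_upper _ _))// ler_nat (diamond_dist_map_le 0%N false).
Qed.

Definition random_embedding x : Lp (lebesgue01 R) p1 Y :=
  \pi_(Lp (lebesgue01 R) p1 Y)%qT (BochnerFun (random_map_bochner x)).

Lemma random_embedding_norm x y : (`|random_embedding x - random_embedding y|)%:E =
  bochner_norm (lebesgue01 R) p (random_map x \- random_map y).
Proof.
rewrite /random_embedding -raddfB.
rewrite [X in X%:E](Lp_norm_pi p1); exact: bochner_fun_fin.
Qed.

Lemma random_map_diff_measurable x y :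
  strongly_measurable (random_map x \- random_map y).
Proof.
by apply: strongly_measurableB; exact/simple_strongly_measurable/simple_random_map.
Qed.

Lemma random_embedding_le x y :
  `|random_embedding x - random_embedding y| <= gdist R x y.
Proof.
rewrite (gdist_is_dist R _ _ (diamond_is_dist 0%N k)).
rewrite -lee_fin random_embedding_norm; apply: bochner_norm_le => //.
- exact: random_map_diff_measurable.
- exact: lebesgue01_setT.
- move=> w; apply: le_trans (f_upper _ _) _.
  by rewrite ler_nat (diamond_dist_map_le 0%N false).
Qed.

(** Applied to the whole space for vertical pairs, and in general to an event of measure at least
    1/2. *)
Lemma random_embedding_ge (A : set (measurableTypeR R)) (m : R) x y :
  measurable A -> 0 <= m -> (m%:E <= lebesgue01 R A)%E ->
  (forall w, A w -> diamond_dist (diamond_vmap (bit w) x)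
     (diamond_vmap (bit w) y) = diamond_dist x y) ->
  m `^ p^-1 * (C^-1 * gdist R x y) <= `|random_embedding x - random_embedding y|.
Proof.
move=> mA m0 mAm Axy; rewrite (gdist_is_dist R _ _ (diamond_is_dist 0%N k)).
rewrite -lee_fin random_embedding_norm; apply: bochner_norm_ge mA m0 mAm _ _ => //.
- exact: random_map_diff_measurable.
- by rewrite mulr_ge0// invr_ge0 (le_trans ler01).
- by move=> w /Axy <-; exact: f_lower.
Qed.

Lemma random_embedding_vertical x y : same_vertical_path R x y ->
  C^-1 * gdist R x y <= `|random_embedding x - random_embedding y|.
Proof.
move=> xy; have := @random_embedding_ge setT 1 x y measurableT ler01.
rewrite powR1 mul1r; apply; first by rewrite lebesgue01_setT.
by move=> w _; exact: (same_vertical_path_dist 0%N false xy).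
Qed.

(** The split of [diamond_dist_map_eq] covers all pairs, vertical or not, so this bound also gives
    the distortion. *)
Lemma random_embedding_lower x y :
  (2 `^ p^-1 * C)^-1 * gdist R x y <= `|random_embedding x - random_embedding y|.
Proof.
have half : (2^-1 : R) `^ p^-1 = (2 `^ p^-1)^-1.
  by rewrite -(powR_inv1 (ler0n R 2)) -powRrM mulN1r powRN.
rewrite invfM -half -mulrA.
have [xy|[i [j [ij xy]]]] := diamond_dist_map_eq 0%N false x y.
  (* Every [h] keeps the distance here; the smaller value 1/2 of [m] gives both cases the same
     constant. *)
  apply: (random_embedding_ge (A := setT)) => //.
  by rewrite lebesgue01_setT lee_fin invf_le1 ?ler1n.
apply: (random_embedding_ge (A := bits_differ i j)) => //.
- exact: measurable_bits_differ.
- exact: lebesgue01_bits_differ.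
- by move=> w wij; exact: xy.
Qed.

End random_embedding.

Theorem theorem3p4 (R : realType) (p : R) (p1 : 1 <= p)
    (Y : completeNormedModType R) (C : R) (C1 : 1 <= C)
    (D2_embeds : forall k : nat,
      embeds_with_distortion (vertex (diamond bool k)) Y
        (gdist R) (@norm_dist R Y) C) :
  (forall k : nat,
    embeds_with_distortion (vertex (diamond nat k))
      (Lp (lebesgue01 R) p1 Y)
      (gdist R) (@norm_dist R (Lp (lebesgue01 R) p1 Y)) (2 `^ p^-1 * C)) /\
  (forall k : nat, (1 <= k)%N ->
    exists phi : vertex (diamond nat k) -> Lp (lebesgue01 R) p1 Y,
      [/\ forall x y, `|phi x - phi y| <= gdist R x y,
          forall x y, same_vertical_path R x y ->
            C^-1 * gdist R x y <= `|phi x - phi y|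
        & forall x y, ~ same_vertical_path R x y ->
            (2 `^ p^-1 * C)^-1 * gdist R x y <= `|phi x - phi y|]).
Proof.
have C0 : 0 < C by exact: lt_le_trans C1.
have p0 : 0 < p by exact: lt_le_trans p1.
have K1 : 1 <= (2 : R) `^ p^-1.
  by rewrite -[leLHS](powRr0 2) ler_powR// ?ler1n// invr_ge0 ltW.
have main k : exists phi : vertex (diamond nat k) -> Lp (lebesgue01 R) p1 Y,
    [/\ forall x y, `|phi x - phi y| <= gdist R x y,
        forall x y, same_vertical_path R x y ->
          C^-1 * gdist R x y <= `|phi x - phi y|
      & forall x y, (2 `^ p^-1 * C)^-1 * gdist R x y <= `|phi x - phi y|].
  have [s s0 [g gP]] := D2_embeds k.
  have Cs0 : 0 < C * s by exact: mulr_gt0.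
  (* Dividing by [C * s], the upper constant of [g], makes [f] 1-Lipschitz and leaves 1/C as the
     lower constant. *)
  pose f v := (C * s)^-1 *: g v.
  have fE u v : `|f u - f v| = (C * s)^-1 * `|g u - g v|.
    by rewrite -scalerBr normrZ gtr0_norm// invr_gt0.
  have gE u v := gdist_is_dist R u v (diamond_is_dist false k).
  have f_lower u v : C^-1 * (diamond_dist u v)%:R <= `|f u - f v|.
    have [+ _] := gP u v; rewrite gE fE invfM -mulrA ler_pM2l ?invr_gt0//.
    by rewrite ler_pdivlMl.
  have f_upper u v : `|f u - f v| <= (diamond_dist u v)%:R.
    by have [_] := gP u v; rewrite gE fE ler_pdivrMl.
  exists (random_embedding p1 f_upper); split.
  - exact: random_embedding_le.
  - exact: random_embedding_vertical.
  - exact: random_embedding_lower.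
split=> k; have [phi [phi1 phiC phiK]] := main k; last first.
  by move=> _; exists phi; split.
have K0 : 0 < 2 `^ p^-1 * C by rewrite mulr_gt0// (lt_le_trans ltr01).
exists (2 `^ p^-1 * C)^-1; first by rewrite invr_gt0.
exists phi => x y; split; first exact: phiK.
by rewrite mulfV ?gt_eqF// mul1r; exact: phi1.
Qed.
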